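(* Let $S$ be an additively reduced and additively Furstenberg semidomain and let $G$ be a torsion-free abelian group, totally ordered compatibly with addition, in which every subset that is bounded below is well-ordered. The following statements are equivalent. (1) $\mathscr{A}_+(S)=S^\times$. (2) Every $f\in S[\![G]\!]$ with $|\operatorname{supp}(f)|>1$ can be expressed as the sum of at most three irreducible elements of $S[\![G]\!]$. (3) There exists $n\in\mathbb{N}$ with $n>2$ such that every $f\in S[\![G]\!]$ with $|\operatorname{supp}(f)|>1$ can be expressed as the sum of at most $n$ irreducible elements of $S[\![G]\!]$.
   Context: A semidomain is a subsemiring (containing $0$ and $1$) of an integral domain; all semirings are commutative. For a semidomain $S$, $S^\times$ denotes the group of units of the multiplicative monoid $S\setminus\{0\}$. $S$ is additively reduced if $0$ is the only invertible element of $(S,+)$. An additive atom of $S$ is a nonzero $a\in S$ such that $a=b+c$ with $b,c\in S$ implies $b=0$ or $c=0$; $\mathscr{A}_+(S)$ is the set of additive atoms. $S$ is additively Furstenberg if every nonzero $s\in S$ can be written $s=a+t$ with $a\in\mathscr{A}_+(S)$, $t\in S$. For a torsion-free abelian group $G$ with a fixed total order compatible with addition, the group series semidomain is $S[\![G]\!]=\{\sum_{i=0}^\infty s_ix^{g_i} : s_i\in S,\ g_i\in G,\ g_i<g_{i+1}\text{ for all } i\}$, with addition and multiplication defined as for (formal) polynomials; elements are written with the convention that $s_i=0$ implies $s_{i+1}=0$. The support of $f=\sum s_ix^{g_i}$ is $\operatorname{supp}(f)=\{g_i : s_i\neq0\}$. An element $f$ is irreducible if it is nonzero, not a unit of $S[\![G]\!]$,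 and $f=pq$ with $p,q\in S[\![G]\!]$ implies one of $p,q$ is a unit.
   Formalization: The group G is additionally assumed nontrivial; for trivial G no element has support of size greater than 1, so (2) and (3) hold vacuously while (1) fails, e.g. for S = N[x]. *)

(* Defs.v *)
From mathcomp Require Import all_boot all_order all_algebra.
Set Implicit Arguments. Unset Strict Implicit. Unset Printing Implicit Defensive.
Import GRing.Theory.
Local Open Scope ring_scope.

(* A semidomain S is modelled as a predicate S on an integral domain R
   (R : idomainType) containing 0, 1 and closed under + and *. *)
Section Semidomain.
Variables (R : idomainType) (S : {pred R}).

Definition is_semidomain : Prop :=
  [/\ 0 \in S, 1 \in S,
      (forall a b, a \in S -> b \in S -> a + b \in S) &
      (forall a b, a \in S -> b \in S -> a * b \in S)].

Definition sunit (u : R) : Prop := u \in S /\ exists2 v, v \in S & u * v = 1.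

Definition add_atom (a : R) : Prop :=
  [/\ a \in S, a != 0 &
      forall b c, b \in S -> c \in S -> a = b + c -> b = 0 \/ c = 0].

Definition add_reduced : Prop :=
  forall a b, a \in S -> b \in S -> a + b = 0 -> a = 0.

Definition add_furstenberg : Prop :=
  forall s, s \in S -> s != 0 -> exists a t, [/\ add_atom a, t \in S & s = a + t].
End Semidomain.

Section OrderedGroup.
Variables (G : zmodType) (le : rel G).

Definition total_order_compat : Prop :=
  [/\ reflexive le, antisymmetric le, transitive le, total le &
      forall a b c, le a b -> le (a + c) (b + c)].

Definition torsion_free : Prop := forall (n : nat) (x : G), x *+ n.+1 = 0 -> x = 0.

Definition bounded_below_well_ordered : Prop :=
  forall B : G -> Prop, (exists m, forall x, B x -> le m x) ->
  forall A : G -> Prop, (forall x, A x -> B x) -> (exists x, A x) ->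
  exists x, A x /\ forall y, A y -> le x y.

Definition ltG (a b : G) : bool := le a b && (a != b).
End OrderedGroup.

(* The group series semidomain S[[G]]: an element sum_i s_i x^{g_i} is
   represented by its coefficient function f : G -> R. *)
Section Series.
Variables (R : idomainType) (S : {pred R}) (G : zmodType) (le : rel G).

Definition is_series (f : G -> R) : Prop :=
  exists g : nat -> G,
    [/\ (forall i, ltG le (g i) (g i.+1)),
        (forall i, f (g i) \in S),
        (forall i, f (g i) = 0 -> f (g i.+1) = 0) &
        (forall x, f x != 0 -> exists i, g i = x)].

Definition is_product (f h p : G -> R) : Prop :=
  forall x, exists s : seq (G * G),
    [/\ uniq s,
        (forall ab, ab \in s <-> (ab.1 + ab.2 = x /\ f ab.1 != 0 /\ h ab.2 != 0)) &
        p x = \sum_(ab <- s) f ab.1 * h ab.2].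

Definition series_one : G -> R := fun x => if x == 0 then 1 else 0.

Definition series_unit (u : G -> R) : Prop :=
  is_series u /\ exists v, is_series v /\ is_product u v series_one.

Definition series_irreducible (f : G -> R) : Prop :=
  [/\ is_series f, exists x, f x != 0, ~ series_unit f &
      forall p q, is_series p -> is_series q -> is_product p q f ->
        series_unit p \/ series_unit q].

Definition supp_gt1 (f : G -> R) : Prop :=
  exists x y, [/\ x != y, f x != 0 & f y != 0].

Definition sum_at_most_irred (n : nat) (f : G -> R) : Prop :=
  exists (k : nat) (ps : nat -> G -> R),
    [/\ (k <= n)%N, (forall i, (i < k)%N -> series_irreducible (ps i)) &
        forall x, f x = \sum_(i < k) ps i x].
End Series.

(* Main.v *)
(* The group G is generated by its least positive element. A series is irreducible
   as soon as it has a term u x^o, with u both a unit and an additive atom, such that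
   t1 + t2 - o never lies in the rest of the support when t1 and t2 do.
   If additive atoms are units, 2-color the support of f by the parity of the
   exponents (after dividing their differences by a common power of 2), pick exponents
   e and o of different colors and split off atoms from both coefficients:
   f_e = u + r, f_o = u' + r'. Then u x^e + r' x^o + (other terms of the color of o)
   and u' x^o + r x^e + (other terms of the color of e) are irreducible, unless one
   of them is a monomial, in which case f itself is irreducible. So two irreducibles
   already suffice.
   Conversely, if a is an additive atom but not a unit, the summands of
   a (1 + x^e + ... + x^(ne)) are a times 0-1 series, so the irreducible ones among
   them are monomials, and n + 1 of them are needed. *)
Require Import Defs.
From mathcomp Require Import all_boot all_order all_algebra.
From mathcomp Require Import boolp zify ring.
Set Implicit Arguments. Unset Strict Implicit. Unset Printing Implicit Defensive.
Import GRing.Theory.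
Local Open Scope ring_scope.

(** * Increasing enumerations of sets of natural numbers *)

Lemma pred_enumeration (P : pred nat) : exists u : nat -> nat,
  [/\ forall i, (u i < u i.+1)%N, forall i, ~~ P (u i) -> ~~ P (u i.+1)
    & forall m, P m -> exists i, u i = m].
Proof.
(* [L n] is the least element of [P] from [n] on, or [n] itself if there is none; so [u] keeps
   increasing after [P] is exhausted. *)
have /choice[L LP] : forall n, exists l, (n <= l)%N /\
    (forall m, (n <= m)%N -> P m -> P l /\ (l <= m)%N).
  move=> n; have [ex|nex] := EM (exists m, (n <= m)%N && P m).
    case: (ex_minnP ex) => l /andP[nl Pl] lmin; exists l; split=> // m nm Pm.
    by split=> //; apply: lmin; rewrite nm Pm.
  exists n; split=> // m nm Pm; case: nex; exists m; by rewrite nm Pm.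
pose fix u i := if i is j.+1 then L (u j).+1 else L 0%N.
have ult i : (u i < u i.+1)%N by have [] := LP (u i).+1.
exists u; split=> // [i|m Pm].
  apply: contraNN => PSi.
  have Pu n : (n <= u i)%N -> (forall m, (n <= m)%N -> P m -> P (u i) /\ (u i <= m)%N) -> P (u i).
    move=> nu H; by have [] := H (u i.+1) (leq_trans nu (ltnW (ult i))) PSi.
  by case: i {PSi} Pu (ult i) => [|i] Pu _;
    [case: (LP 0%N)|case: (LP (u i).+1)] => H1 H2; apply: Pu H1 H2.
have reach k i : (u i <= m)%N -> (m - u i <= k)%N -> exists j, u j = m.
  elim: k i => [|k IH] i im mk; first by exists i; lia.
  have [<-|ne] := eqVneq (u i) m; first by exists i.
  have im' : (u i < m)%N by lia.
  have [H1 /(_ m im' Pm) [_ H2]] := LP (u i).+1.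
  by apply: (IH i.+1); rewrite /=; lia.
apply: (reach m 0%N) => /=; last by lia.
by have [_ /(_ m (leq0n m) Pm) []] := LP 0%N.
Qed.

(** * Finite sums and units in an additively reduced semidomain *)

Section Semidomain.
Variables (R : idomainType) (S : {pred R}).
Hypotheses (Ssd : is_semidomain S) (Sred : add_reduced S).

Lemma semidomain_sum (I : eqType) (s : seq I) (F : I -> R) :
  (forall i, i \in s -> F i \in S) -> \sum_(i <- s) F i \in S.
Proof.
case: Ssd => S0 _ SD _ FS; rewrite big_seq.
by elim/big_ind: _.
Qed.

Lemma add_reduced_sum_eq0 (I : eqType) (s : seq I) (F : I -> R) :
  (forall i, i \in s -> F i \in S) -> \sum_(i <- s) F i = 0 ->
  forall i, i \in s -> F i = 0.
Proof.
move=> FS s0 i si; apply: (Sred (b := \sum_(j <- rem i s) F j)).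
- exact: FS.
- by apply: semidomain_sum => j /mem_rem; apply: FS.
- by move: s0; rewrite (big_rem _ si).
Qed.

(** The Furstenberg property splits an atom [b] off 1. Multiplied by [b / a], a splitting of [a]
    becomes one of [b], hence is trivial. *)
Lemma sunit_add_atom : add_furstenberg S -> forall a, sunit S a -> add_atom S a.
Proof.
case: Ssd => _ S1 SD SM Sf a [Sa [v Sv av]].
have [b [_ [[Sb b0 batom] _ _]]] := Sf 1 S1 (oner_neq0 _).
split=> // [|c d Sc Sd acd].
  by apply/eqP => a0; move: (oner_neq0 R); rewrite -av a0 mul0r eqxx.
have bE : b = b * v * c + b * v * d.
  by rewrite -mulrDr -acd -mulrA [v * a]mulrC av mulr1.
have v0 : v != 0.
  by apply/eqP => v0; move: (oner_neq0 R); rewrite -av v0 mulr0 eqxx.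
have bv0 : b * v != 0 by rewrite mulf_neq0.
by have [] := batom _ _ (SM _ _ (SM _ _ Sb Sv) Sc) (SM _ _ (SM _ _ Sb Sv) Sd) bE;
  move/eqP; rewrite mulf_eq0 (negPf bv0) => /eqP; [left|right].
Qed.

End Semidomain.

(** * Totally ordered groups and cyclicity *)

Section Order.
Variables (G : zmodType) (le : rel G).
Hypothesis leG : total_order_compat le.

Lemma leG_trans y x z : le x y -> le y z -> le x z.
Proof. by case: leG => _ _ tr _ _; apply: tr. Qed.

Lemma leG_anti x y : le x y -> le y x -> x = y.
Proof. by case: leG => _ an _ _ _ xy yx; apply: an; rewrite xy yx. Qed.

Lemma leG_add2r z x y : le (x + z) (y + z) = le x y.
Proof.
case: leG => _ _ _ _ mono; apply/idP/idP => [/(mono _ _ (- z))|]; last exact: mono.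
by rewrite !addrK.
Qed.

Lemma ltG_add2r z x y : ltG le (x + z) (y + z) = ltG le x y.
Proof. by rewrite /ltG leG_add2r (inj_eq (addIr z)). Qed.

Lemma exists_posG : (exists g : G, g != 0) -> exists e, ltG le 0 e.
Proof.
case=> g g0; case: leG => _ _ _ tot _; case/orP: (tot 0 g) => [le0g|leg0].
  by exists g; rewrite /ltG le0g eq_sym.
exists (- g); rewrite -(ltG_add2r g) add0r addNr /ltG leg0; exact: g0.
Qed.

Lemma ltG_progression c e i : ltG le 0 e -> ltG le (c + e *+ i) (c + e *+ i.+1).
Proof.
by move=> e0; rewrite mulrS addrCA -{1}[c + _]add0r ltG_add2r.
Qed.

(** Division with remainder by the least positive element [e]: the least nonnegative [x - e *+ n] is
    smaller than [e], hence 0. *)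
Lemma wellordered_cyclic : bounded_below_well_ordered le -> (exists g : G, g != 0) ->
  exists e : G, e != 0 /\ forall x : G, exists n : int, x = e *~ n.
Proof.
move=> wo /exists_posG expos.
have [] := wo (fun y => le 0 y) _ (fun y => ltG le 0 y) _ expos; first by exists 0.
  by move=> x /andP[].
move=> e [epos emin]; exists e; split; first by case/andP: epos => _; rewrite eq_sym.
have nonneg x : le 0 x -> exists n : nat, x = e *+ n.
  move=> x0.
  have [] := wo (fun y => le 0 y) _ (fun y => le 0 y /\ exists n, y = x - e *+ n).
  - by exists 0.
  - by move=> y [].
  - by exists x; split=> //; exists 0%N; rewrite mulr0n subr0.
  move=> y [[y0 [n yE]] ymin]; exists n.
  have [y00|yn0] := eqVneq y 0; first by apply/eqP; rewrite -subr_eq0 -yE y00.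
  have ey : le e y by apply: emin; rewrite /ltG y0 eq_sym.
  have /ymin : le 0 (y - e) /\ exists n, y - e = x - e *+ n.
    split; first by rewrite -(leG_add2r e) add0r subrK.
    by exists n.+1; rewrite yE mulrSr opprD addrA.
  rewrite -(leG_add2r (e - y)) subrKC addrA subrK subrr => le_e0.
  by case/andP: epos => le0e /eqP; case; apply: leG_anti.
move=> x; case: (leG) => _ _ _ tot _; case/orP: (tot 0 x) => [/nonneg[n ->]|x0].
  by exists n%:Z.
have /nonneg[n xE] : le 0 (- x) by rewrite -(leG_add2r x) add0r addNr.
by exists (- n%:Z); rewrite mulrNz -pmulrn -xE opprK.
Qed.

End Order.

(** * Group series: supports, units and an irreducibility criterion *)

Section Series.
Variables (R : idomainType) (S : {pred R}) (G : zmodType) (le : rel G).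
Hypotheses (Ssd : is_semidomain S) (Sred : add_reduced S).
Hypotheses (leG : total_order_compat le) (Gnt : exists g : G, g != 0).
Implicit Types f p q : G -> R.

Lemma is_series_coef f x : is_series S le f -> f x \in S.
Proof.
case=> g [_ fS _ fg]; have [->|/fg[i <-]] := eqVneq (f x) 0; last exact: fS.
by case: Ssd.
Qed.

(** [is_series] asks that coefficients stay 0 once they vanish; thinning out [g] by
    [pred_enumeration] achieves this. *)
Lemma is_series_enumerated f (g : nat -> G) :
  (forall i, ltG le (g i) (g i.+1)) -> (forall x, f x \in S) ->
  (forall x, f x != 0 -> exists i, g i = x) -> is_series S le f.
Proof.
move=> gS fS fg; have [u [uS uP uex]] := pred_enumeration (fun i => f (g i) != 0).
exists (g \o u); split=> [i|i|i|x] /=.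
- have lt_trans a b c : ltG le a b -> ltG le b c -> ltG le a c.
    move=> /andP[ab anb] /andP[bc _]; rewrite /ltG (leG_trans leG ab bc) /=.
    by apply: contraNneq anb => ac; subst c; apply/eqP/(leG_anti leG).
  elim: (u i.+1) (uS i) => // m IH; rewrite ltnS leq_eqVlt => /orP[/eqP->//|/IH].
  by move/lt_trans; apply.
- exact: fS.
- by move=> fi0; apply/eqP/negPn; apply: uP; rewrite fi0 eqxx.
- move=> fx0; have [i gi] := fg x fx0; have [|j uj] := uex i; first by rewrite gi.
  by exists j; rewrite uj.
Qed.

Lemma is_series_sub f p : is_series S le f -> (forall x, p x \in S) ->
  (forall x, p x != 0 -> f x != 0) -> is_series S le p.
Proof.
move=> [g [gS _ _ fg]] pS pf; apply: (is_series_enumerated gS) => // x /pf; exact: fg.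
Qed.

Definition series_monomial (a : R) (g : G) : G -> R := fun x => if x == g then a else 0.

Lemma is_series_monomial a g : a \in S -> is_series S le (series_monomial a g).
Proof.
(* Even a monomial needs an infinite increasing sequence of exponents; multiples of a positive [e]
   continue it beyond [g]. *)
move=> Sa; have [e e0] := exists_posG leG Gnt; case: (Ssd) => S0 _ _ _.
apply: (@is_series_enumerated _ (fun i => g + e *+ i)) => [i|x|x].
- exact: ltG_progression.
- by rewrite /series_monomial; case: ifP.
- rewrite /series_monomial; case: (x =P g) => [->|_]; last by rewrite eqxx.
  by exists 0%N; rewrite mulr0n addr0.
Qed.

Lemma is_product_monomial a g q : a != 0 ->
  is_product (series_monomial a g) q (fun x => a * q (x - g)).
Proof.
move=> a0 x; exists (if q (x - g) != 0 then [:: (g, x - g)] else [::]); split.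
- by case: ifP.
- move=> [b c] /=; rewrite /series_monomial; split.
    case: ifP => // qx; rewrite inE => /eqP[-> ->].
    by rewrite eqxx subrKC.
  case=> <- [+ qc]; case: (b =P g) => [->|]; last by rewrite eqxx.
  by rewrite addrAC subrr add0r qc inE eqxx.
- case: ifP => [_|/negbFE/eqP->]; last by rewrite big_nil mulr0.
  by rewrite big_seq1 /series_monomial eqxx.
Qed.

Lemma series_unit_monomial p a : is_series S le p -> sunit S (p a) ->
  (forall x, p x != 0 -> x = a) -> series_unit S le p.
Proof.
move=> sp [_ [v Sv pv]] pmon; split=> //; exists (series_monomial v (- a)).
split; first exact: is_series_monomial.
have pa0 : p a != 0.
  by apply/eqP => pa0; move: (oner_neq0 R); rewrite -pv pa0 mul0r eqxx.
have -> : p = series_monomial (p a) a.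
  apply/funext => x; rewrite /series_monomial; case: (x =P a) => [->//|nxa].
  by apply/eqP/negPn/negP => /pmon.
have := is_product_monomial a (series_monomial v (- a)) pa0; congr is_product.
apply/funext => x; rewrite /series_one /series_monomial subr_eq addrC subrr.
by case: ifP; rewrite ?mulr0.
Qed.

(** No cancellation: by reducedness a vanishing sum has only zero terms, but [p a * q b] is
    nonzero. *)
Lemma is_product_neq0 f p q a b : is_series S le p -> is_series S le q ->
  is_product p q f -> p a != 0 -> q b != 0 -> f (a + b) != 0.
Proof.
move=> sp sq pq pa qb; have [s [_ sE ->]] := pq (a + b).
apply/eqP => s0; have abs : (a, b) \in s by apply/sE.
suff /(_ _ abs)/eqP : forall ab, ab \in s -> p ab.1 * q ab.2 = 0.
  by rewrite mulf_eq0 (negPf pa) (negPf qb).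
apply: (add_reduced_sum_eq0 Ssd Sred) s0 => i _; case: (Ssd) => _ _ _; apply; exact: is_series_coef.
Qed.

(** Once one nonzero term is split off the atom [f o], the remaining sum vanishes, and by
    reducedness so does each of its terms. *)
Lemma is_product_add_atom f p q o : is_series S le p -> is_series S le q ->
  is_product p q f -> add_atom S (f o) ->
  exists a b, [/\ a + b = o, p a != 0 /\ q b != 0, f o = p a * q b &
    forall a' b', a' + b' = o -> p a' != 0 -> q b' != 0 -> a' = a].
Proof.
move=> sp sq pq [Sfo fo0 fatom]; have [s [us sE fE]] := pq o.
have FS ab : p ab.1 * q ab.2 \in S.
  by case: (Ssd) => _ _ _; apply; apply: is_series_coef.
have [s0|[[a b] abs]] : s = [::] \/ exists ab, ab \in s.
- by case: (s) => [|ab s']; [left|right; exists ab; rewrite inE eqxx].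
- by move: fo0; rewrite fE s0 big_nil eqxx.
have /sE /= [abo [pa qb]] := abs.
move: fE; rewrite (big_rem _ abs) /= => fE.
have Srest : \sum_(ab <- rem (a, b) s) p ab.1 * q ab.2 \in S.
  by apply: semidomain_sum.
have [/eqP|rest0] := fatom _ _ (FS (a, b)) Srest fE.
  by rewrite mulf_eq0 (negPf pa) (negPf qb).
exists a, b; split=> //; first by rewrite fE rest0 addr0.
move=> a' b' abo' pa' qb'; apply/eqP/negPn/negP => a'a.
have : (a', b') \in rem (a, b) s.
  rewrite mem_rem_uniq // inE xpair_eqE (negPf a'a) /=.
  by apply/sE.
move/(add_reduced_sum_eq0 Ssd Sred (fun i _ => FS i) rest0)/eqP.
by rewrite /= mulf_eq0 (negPf pa') (negPf qb').
Qed.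

(** For an exponent [z] of the inverse, absence of cancellation forces [t + z = 0] for every
    exponent [t] of [u]. *)
Lemma series_unit_supp1 u x y : series_unit S le u -> u x != 0 -> u y != 0 -> x = y.
Proof.
move=> [su [v [sv uv]]] ux uy.
have [z vz] : exists z, v z != 0.
  have [s [_ sE]] := uv 0; rewrite /series_one eqxx.
  case: s sE => [|ab s'] sE; first by rewrite big_nil => /eqP; rewrite oner_eq0.
  by move=> _; exists ab.2; have /sE[_ []] : ab \in ab :: s' by rewrite inE eqxx.
have supp0 t : u t != 0 -> t + z = 0.
  move=> ut; have := is_product_neq0 su sv uv ut vz.
  by rewrite /series_one; case: (t + z =P 0) => //; rewrite eqxx.
by apply: (addIr z); rewrite !supp0.
Qed.

(* Suppose f = p q and p a q b is the only contribution to the coefficient at o.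
   If a' and b' were further exponents of p and q, then with t1 = a' + b and
   t2 = a + b' the exponent a' + b' = t1 + t2 - o would violate the last hypothesis. *)
Lemma series_irreducible_exponent f o : is_series S le f ->
  add_atom S (f o) -> sunit S (f o) -> (exists t, t != o /\ f t != 0) ->
  (forall t1 t2, t1 != o -> t2 != o -> f t1 != 0 -> f t2 != 0 ->
     t1 + t2 - o != o -> f (t1 + t2 - o) = 0) ->
  series_irreducible S le f.
Proof.
move=> sf atom_fo [_ [v Sv fov]] [t [to ft]] gap.
have fo0 : f o != 0 by case: atom_fo.
split=> //; first by exists o.
  by move=> uf; move: to; rewrite (series_unit_supp1 uf ft fo0) eqxx.
move=> p q sp sq pq.
have [a [b [abo [pa qb] foE uniq_ab]]] := is_product_add_atom sp sq pq atom_fo.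
have [Spa Sqb] := (is_series_coef a sp, is_series_coef b sq).
have SM x y : x \in S -> y \in S -> x * y \in S by case: (Ssd) => _ _ _; apply.
(* If [a] is the only exponent of [p], then [p] is a monomial whose coefficient divides the unit
   [f o]; likewise for [q] and [b]. *)
have [[a' [a'a pa']]|na] := EM (exists a', a' != a /\ p a' != 0); last first.
  left; apply: (@series_unit_monomial _ a) => //.
    by split=> //; exists (q b * v); [exact: SM|rewrite mulrA -foE].
  by move=> x px; apply/eqP/negPn/negP => xa; apply: na; exists x.
have [[b' [b'b qb']]|nb] := EM (exists b', b' != b /\ q b' != 0); last first.
  right; apply: (@series_unit_monomial _ b) => //.
    by split=> //; exists (p a * v); [exact: SM|rewrite mulrA [q b * _]mulrC -foE].
  by move=> x qx; apply/eqP/negPn/negP => xb; apply: nb; exists x.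
have t12 : a' + b + (a + b') - o = a' + b' by rewrite addrACA [b + b']addrC addrACA abo addrK.
have := gap (a' + b) (a + b'); rewrite t12 => H.
have f12 := is_product_neq0 sp sq pq pa' qb'; move/eqP: (f12); case; apply: H.
- by rewrite -abo (inj_eq (addIr b)).
- by rewrite -abo (inj_eq (addrI a)).
- exact: is_product_neq0 pq _ _.
- exact: is_product_neq0 pq _ _.
- by apply: contraNneq a'a => ab'; apply/eqP; apply: uniq_ab ab' _ _.
Qed.

End Series.

(** * Torsion-free cyclic groups and parity colorings *)

Lemma torsion_free_mulrn_inj (G : zmodType) (e : G) : torsion_free G -> e != 0 ->
  injective (fun i : nat => e *+ i).
Proof.
move=> tf e0.
have aux i d : e *+ (i + d) = e *+ i -> d = 0%N.
  rewrite mulrnDr => /eqP; rewrite -subr_eq0 addrAC subrr add0r => /eqP.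
  by case: d => // d /tf/eqP; rewrite (negPf e0).
move=> i j /= ij; case: (leqP i j) => [le_ij|/ltnW le_ji].
  by have := aux i (j - i)%N; rewrite subnKC // => /(_ (esym ij)); lia.
by have := aux j (i - j)%N; rewrite subnKC // => /(_ ij); lia.
Qed.

Lemma torsion_free_mulrz_inj (G : zmodType) (e : G) : torsion_free G -> e != 0 ->
  injective (fun n : int => e *~ n).
Proof.
move=> tf e0 m n /= mn.
have : e *~ (m - n) = 0 by rewrite mulrzBr mn subrr.
case dE: (m - n) => [d|d].
  rewrite -pmulrn -[0](mulr0n e) => /(torsion_free_mulrn_inj tf e0) d0.
  by move: dE; rewrite d0; lia.
by rewrite NegzE mulrNz -pmulrn => /eqP; rewrite oppr_eq0 => /eqP/tf/eqP; rewrite (negPf e0).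
Qed.

(** Modulo 2, equal parities of [y] and [z] cancel, so [y + z - x] has the parity of [x]; this is
    what the irreducibility criterion uses. *)
Definition parity_coloring (G : zmodType) (T : G -> Prop) (c : G -> bool) : Prop :=
  forall x y z, T x -> T y -> T z -> c y = c z -> c x = ~~ c y -> c (y + z - x) = c x.

Lemma parity_coloringN (G : zmodType) (T : G -> Prop) c :
  parity_coloring T c -> parity_coloring T (fun x => ~~ c x).
Proof.
by move=> cP x y z Tx Ty Tz /negb_inj cyz /negb_inj cxy; rewrite (cP x y z).
Qed.

(* Color by the parity of (t - t0) / 2^v, where 2^v is the largest power of 2
   dividing all the differences t - t0. *)
Lemma parity_coloring_exists (G : zmodType) (e : G) (T : G -> Prop) t0 t1 :
  torsion_free G -> e != 0 -> (forall x, exists n : int, x = e *~ n) ->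
  T t0 -> T t1 -> t0 != t1 ->
  exists c, [/\ parity_coloring T c, exists2 x, T x & c x & exists2 x, T x & ~~ c x].
Proof.
move=> tf e0 /choice[phi phiE] Tt0 Tt1 t01.
have phiD x y : phi (x + y) = phi x + phi y.
  by apply: (torsion_free_mulrz_inj tf e0); rewrite /= mulrzDr -!phiE.
have phiN x : phi (- x) = - phi x.
  by apply: (torsion_free_mulrz_inj tf e0); rewrite /= mulrNz -!phiE.
pose d x := phi x - phi t0.
have [v [dv [t Tt ndt]]] : exists v : nat,
    (forall x, T x -> ((2 ^ v)%N%:Z %| d x)%Z) /\
    (exists2 x, T x & ~~ ((2 ^ v.+1)%N%:Z %| d x)%Z).
  (* Otherwise every power of 2 would divide the nonzero difference [d t1]. *)
  apply: contrapT => nv.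
  have all_dvd v x : T x -> ((2 ^ v)%N%:Z %| d x)%Z.
    elim: v x => [|v IH] x Tx; first by rewrite dvd1z.
    by apply: contrapT => /negP ndx; apply: nv; exists v; split=> //; exists x.
  have dt1 : (0 < `|d t1|)%N.
    rewrite absz_gt0 subr_eq0; apply: contraNneq t01 => phi10.
    by rewrite (phiE t0) (phiE t1) phi10.
  have := all_dvd `|d t1|%N t1 Tt1; rewrite dvdzE => /(dvdn_leq dt1).
  by rewrite leqNgt ltn_expl.
pose c x := ((2 ^ v.+1)%N%:Z %| d x)%Z.
exists c; split; [|by exists t0; rewrite // /c /d subrr dvdz0|by exists t].
(* For [d x = k * 2 ^ v], the color of [x] tells whether [k] is even. *)
have cE x k : d x = k * (2 ^ v)%N%:Z -> c x = (2 %| k)%Z.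
  by move=> dx; rewrite /c dx expnS PoszM dvdz_mul2r // eqz_nat -lt0n expn_gt0.
move=> x y z /dv/dvdzP[kx dx] /dv/dvdzP[ky dy] /dv/dvdzP[kz dz].
have dxyz : d (y + z - x) = (ky + kz - kx) * (2 ^ v)%N%:Z.
  by rewrite mulrBl mulrDl -dx -dy -dz /d !phiD phiN; ring.
by rewrite (cE _ _ dx) (cE _ _ dy) (cE _ _ dz) (cE _ _ dxyz); lia.
Qed.

(** * The pieces of a series cut along a coloring *)

Section Decomposition.
Variables (R : idomainType) (S : {pred R}) (G : zmodType) (le : rel G).
Hypotheses (Ssd : is_semidomain S) (Sred : add_reduced S).
Hypotheses (leG : total_order_compat le) (Gnt : exists g : G, g != 0).
Hypothesis atomE : forall a, add_atom S a <-> sunit S a.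
Variable f : G -> R.
Hypothesis sf : is_series S le f.

(* The part of f outside the color class of e, with t in place of the
   coefficient at o, together with the term of coefficient u at e. *)
Definition color_piece (c : G -> bool) (e : G) (u : R) (o : G) (t : R) : G -> R :=
  fun x => if x == e then u else if c x then 0 else if x == o then t else f x.

Variables (c : G -> bool) (e o : G).
Hypotheses (cP : parity_coloring (fun x => f x != 0) c).
Hypotheses (ce : c e) (co : ~~ c o) (fe : f e != 0) (fo : f o != 0).

(** In the piece [e] is the only exponent of its color, and [y + z - e] has that color when [y] and
    [z] have the other one; the criterion applies at [e]. *)
Lemma color_piece_irreducible u t : add_atom S u -> t \in S ->
  (exists x, x != e /\ color_piece c e u o t x != 0) ->
  series_irreducible S le (color_piece c e u o t).
Proof.
move=> uatom St ex; have [Su _ _] := uatom.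
have supp x : color_piece c e u o t x != 0 -> f x != 0.
  rewrite /color_piece; case: (x =P e) => [->//|_]; case: ifP => _; rewrite ?eqxx //.
  by case: (x =P o) => [->|].
have ee : color_piece c e u o t e = u by rewrite /color_piece eqxx.
have nc x : x != e -> color_piece c e u o t x != 0 -> c x = false.
  by rewrite /color_piece => /negPf->; case: ifP; rewrite ?eqxx.
apply: (@series_irreducible_exponent _ _ _ _ Ssd Sred leG Gnt _ e) => //.
- apply: (is_series_sub leG sf) => // x; rewrite /color_piece.
  case: ifP => // _; case: ifP => _; first by case: Ssd.
  by case: ifP => // _; apply: is_series_coef sf.
- by rewrite ee.
- by rewrite ee; apply/atomE.
move=> y z ye ze fy fz xe; rewrite /color_piece (negPf xe).
by rewrite (cP (x := e)) ?ce ?nc // supp.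
Qed.

(** If the piece is a monomial, then [t = 0], so [f o] is itself an atom, and [o] is the only
    exponent of its color in [f]; the criterion applies to [f] at [o]. *)
Lemma color_piece_singleton u t : add_atom S (f o - t) ->
  ~ (exists x, x != e /\ color_piece c e u o t x != 0) -> series_irreducible S le f.
Proof.
move=> uatom nex.
have oe : o != e by apply: contraNneq co => ->.
have t0 : t = 0.
  apply/eqP/negPn/negP => t0; apply: nex; exists o.
  by rewrite /color_piece (negPf oe) (negPf co) eqxx.
have cx x : x != o -> f x != 0 -> c x.
  move=> xo fx; apply/negPn/negP => ncx; apply: nex; exists x.
  rewrite /color_piece (negPf xo) (negPf ncx).
  have xe : x != e by apply: contraNneq ncx => ->.
  by rewrite (negPf xe).
move: uatom; rewrite t0 subr0 => foatom.
apply: (@series_irreducible_exponent _ _ _ _ Ssd Sred leG Gnt _ o) => //.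
- exact/atomE.
- by exists e; rewrite eq_sym.
move=> y z yo zo fy fz xo; apply/eqP/negPn/negP => fx.
have := cx _ xo fx; rewrite (cP (x := o)) // ?(cx y) ?(cx z) // (negPf co) //.
Qed.

End Decomposition.

(** * Sums of irreducibles and the equivalence *)

Section Equivalence.
Variables (R : idomainType) (S : {pred R}) (G : zmodType) (le : rel G).
Hypotheses (Ssd : is_semidomain S) (Sred : add_reduced S) (Sf : add_furstenberg S).
Hypotheses (leG : total_order_compat le) (Gnt : exists g : G, g != 0).
Hypothesis (tfG : torsion_free G).

Lemma sum_two_irreducibles f :
  bounded_below_well_ordered le -> (forall a, add_atom S a <-> sunit S a) ->
  is_series S le f -> supp_gt1 f -> sum_at_most_irred S le 2 f.
Proof.
move=> wo atomE sf [t0 [t1 [t01 ft0 ft1]]].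
have [g [g0 gen]] := wellordered_cyclic leG wo Gnt.
have [c [cP [e fe ce] [o fo co]]] :=
  parity_coloring_exists (T := fun x => f x != 0) tfG g0 gen ft0 ft1 t01.
have [u1 [r1 [u1atom Sr1 feE]]] := Sf (is_series_coef Ssd e sf) fe.
have [u2 [r2 [u2atom Sr2 foE]]] := Sf (is_series_coef Ssd o sf) fo.
have irr1 : series_irreducible S le f -> sum_at_most_irred S le 2 f.
  by move=> irrf; exists 1%N, (fun _ => f); split=> // x; rewrite big_ord1.
have cnP := parity_coloringN cP; have cne : ~~ ~~ c e by rewrite ce.
have [ex1|nex1] := EM (exists x, x != e /\ color_piece f c e u1 o r2 x != 0); last first.
  apply: irr1; apply: (color_piece_singleton Ssd Sred leG Gnt atomE sf cP ce co fe fo _ nex1).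
  by rewrite foE addrK.
have [ex2|nex2] := EM (exists x, x != o /\ color_piece f (fun x => ~~ c x) o u2 e r1 x != 0);
  last first.
  apply: irr1; apply: (color_piece_singleton Ssd Sred leG Gnt atomE sf cnP co cne fo fe _ nex2).
  by rewrite feE addrK.
exists 2%N, (fun i => if i is 0%N then color_piece f c e u1 o r2
  else color_piece f (fun x => ~~ c x) o u2 e r1); split=> // [[|i] _|x].
- exact: color_piece_irreducible ex1.
- exact: color_piece_irreducible ex2.
(* The pieces contribute [u1] and [r1] at [e], [r2] and [u2] at [o]; elsewhere exactly one of them
   carries [f x]. *)
rewrite !big_ord_recl big_ord0 addr0 /= /color_piece.
case: (x =P e) => [->|_].
  have -> : (e == o) = false by apply: contraTF ce => /eqP->.
  by rewrite ce.
by case: (x =P o) => [->|_]; [rewrite (negPf co) addrC|case: (c x); rewrite ?add0r ?addr0].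
Qed.

(** The coefficient 1 of the product at 0 is an additive atom, so it comes from a single term
    [a * v b']. *)
Lemma sunit_of_series_unit a g : a != 0 -> series_unit S le (series_monomial a g) ->
  sunit S a.
Proof.
move=> a0 [sa [v [sv av]]].
have Sa : a \in S by have := is_series_coef Ssd g sa; rewrite /series_monomial eqxx.
have [|b [b' [_ [ab vb] abE _]]] := is_product_add_atom Ssd Sred (o := 0) sa sv av.
  rewrite /series_one eqxx; apply: sunit_add_atom => //.
  by case: Ssd => _ S1 _ _; split=> //; exists 1; rewrite ?mulr1.
split=> //; exists (v b'); first exact: is_series_coef sv.
move: ab abE; rewrite /series_one /series_monomial eqxx.
by case: ifP => _; rewrite ?eqxx // => _ ->.
Qed.

(** [p] is the constant [a] times the 0-1 series [h] of its support. The constant is not a unit, so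
    [h] is one and has a single exponent. *)
Lemma irreducible_supp1 a p : add_atom S a -> ~ sunit S a ->
  series_irreducible S le p -> (forall x, p x = 0 \/ p x = a) ->
  forall x y, p x != 0 -> p y != 0 -> x = y.
Proof.
move=> [Sa a0 _] nua [sp _ _ irrp] pa x y px py.
pose h x := if p x != 0 then 1 else 0 : R.
have [S0 S1 _ _] := Ssd.
have sh : is_series S le h.
  apply: (is_series_sub leG sp) => z; rewrite /h; first by case: ifP.
  by case: ifP; rewrite ?eqxx.
have pE : (fun x => a * h (x - 0)) = p.
  apply/funext => z; rewrite /h subr0; case: (pa z) => ->; first by rewrite eqxx mulr0.
  by rewrite a0 mulr1.
have := irrp _ h (is_series_monomial Ssd leG Gnt 0 Sa) sh.
rewrite -{1}pE => /(_ (is_product_monomial _ _ a0)) [/(sunit_of_series_unit a0)//|uh].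
by apply: (series_unit_supp1 Ssd Sred uh); rewrite /h ?px ?py oner_neq0.
Qed.

Lemma add_atom_sunit n : (0 < n)%N ->
  (forall f, is_series S le f -> supp_gt1 f -> sum_at_most_irred S le n f) ->
  forall a, add_atom S a -> sunit S a.
Proof.
move=> n0 sumn a aatom; apply: contrapT => nua; have [Sa a0 asum] := aatom.
have [e epos] := exists_posG leG Gnt.
have e0 : e != 0 by case/andP: epos; rewrite eq_sym.
have S0 : 0 \in S by case: Ssd.
(* The support has [n + 1] exponents, one more than [n] monomials can cover. *)
pose F x := if [exists i : 'I_n.+1, x == e *+ i] then a else 0.
have FE (i : 'I_n.+1) : F (e *+ i) = a.
  by rewrite /F; case: existsP => // -[]; exists i.
have sF : is_series S le F.
  apply: (@is_series_enumerated _ _ _ _ leG _ (fun i => 0 + e *+ i)) => [i|x|x].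
  - exact: ltG_progression.
  - by rewrite /F; case: ifP.
  - rewrite /F; case: existsP => [[i /eqP->] _|]; last by rewrite eqxx.
    by exists i; rewrite add0r.
have [|k [ps [kn irr FpsE]]] := sumn F sF.
  exists (e *+ (ord0 : 'I_n.+1)), (e *+ (ord_max : 'I_n.+1)); rewrite !FE a0; split=> //.
  apply/eqP => /(torsion_free_mulrn_inj tfG e0) /= n00.
  by rewrite -n00 in n0.
have psS (j : 'I_k) x : ps j x \in S.
  by have [sp _ _ _] := irr j (ltn_ord j); apply: is_series_coef sp.
(* Each coefficient of [F] is 0 or the atom [a], and neither splits into two nonzero parts. *)
have psa (j : 'I_k) x : ps j x = 0 \/ ps j x = a.
  have := FpsE x; rewrite (bigD1 j) //= => Fx.
  have Srest : \sum_(i < k | i != j) ps i x \in S.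
    by rewrite -big_filter; apply: semidomain_sum.
  move: Fx; rewrite /F; case: ifP => _ Fx.
    have [->|r0] := asum _ _ (psS j x) Srest Fx; first by left.
    by right; rewrite Fx r0 addr0.
  by left; apply: Sred (psS j x) Srest (esym Fx).
(* [J] picks for each exponent a summand containing it; as each summand has one exponent only, [J]
   is injective, against [k <= n]. *)
have /choice[J JP] : forall i : 'I_n.+1, exists j : 'I_k, ps j (e *+ i) != 0.
  move=> i; apply: contrapT => nj; move: (FpsE (e *+ i)); rewrite FE big1.
    by move/eqP; rewrite (negPf a0).
  by move=> j _; apply/eqP/negPn/negP => pj; apply: nj; exists j.
have Jinj : injective J.
  move=> i i' Jii'; apply/val_inj/(torsion_free_mulrn_inj tfG e0) => /=.
  apply: (irreducible_supp1 aatom nua (irr (J i) (ltn_ord _)) (psa (J i))) => //.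
  by rewrite Jii'.
by have := leq_card J Jinj; rewrite !card_ord; lia.
Qed.

End Equivalence.

Theorem theorem4p6 (R : idomainType) (S : {pred R}) (G : zmodType) (le : rel G) :
  is_semidomain S -> add_reduced S -> add_furstenberg S ->
  total_order_compat le -> torsion_free G -> bounded_below_well_ordered le ->
  (exists g : G, g != 0) ->
  [/\ ((forall a, add_atom S a <-> sunit S a) <->
       (forall f, is_series S le f -> supp_gt1 f -> sum_at_most_irred S le 3 f)),
      ((forall f, is_series S le f -> supp_gt1 f -> sum_at_most_irred S le 3 f) <->
       (exists n : nat, (2 < n)%N /\
          forall f, is_series S le f -> supp_gt1 f -> sum_at_most_irred S le n f)) &
      ((forall a, add_atom S a <-> sunit S a) <->
       (exists n : nat, (2 < n)%N /\
          forall f, is_series S le f -> supp_gt1 f -> sum_at_most_irred S le n f))].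
Proof.
move=> Ssd Sred Sf leG tfG wo Gnt.
set P1 := forall a, _; set P2 := forall f, _; set P3 := exists n, _.
have P12 : P1 -> P2.
  move=> atomE f sf f2; have [k [ps [k2 irr fE]]] :=
    sum_two_irreducibles Ssd Sred Sf leG Gnt tfG wo atomE sf f2.
  by exists k, ps; split=> //; apply: leq_trans k2 _.
have P23 : P2 -> P3 by move=> sum3; exists 3%N.
have P31 : P3 -> P1.
  move=> [n [n2 sumn]] a; split; last exact: sunit_add_atom.
  by apply: (add_atom_sunit Ssd Sred Sf leG Gnt tfG _ sumn); lia.
by split; split; auto.
Qed.
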